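(* Let $S \in GL_n(\mathbb{R})$ be a Perron similarity. Then $\mathcal{C}_r(S) \subseteq \mathcal{C}(S)$ if and only if $S$ is row Hadamard conic.
   Context: All inequalities between matrices or vectors are entrywise. A matrix $S \in GL_n(\mathbb{R})$ is called a Perron similarity if there is a real, diagonal, nonscalar matrix $D$ (i.e. $D$ is not a scalar multiple of the identity) such that $S D S^{-1} \geq 0$. For $x \in \mathbb{R}^n$, $\operatorname{diag}(x)$ denotes the diagonal matrix with diagonal entries the entries of $x$. The spectracone of $S$ is $\mathcal{C}(S) := \{x \in \mathbb{R}^n : S \operatorname{diag}(x) S^{-1} \geq 0\}$. The row cone $\mathcal{C}_r(S)$ is the convex cone generated by the rows of $S$, i.e. the set of all linear combinations of the rows of $S$ with nonnegative coefficients. Row vectors and column vectors of length $n$ are identified when comparing $\mathcal{C}_r(S)$ and $\mathcal{C}(S)$ as subsets of $\mathbb{R}^n$. Let $r_1,\dots,r_n$ denote the rows of $S$ and let $\circ$ denote the Hadamard (entrywise) product. $S$ is called row Hadamard conic (RHC) if $r_i \circ r_j \in \mathcal{C}_r(S)$ for all $i,j \in \{1,\dots,n\}$. *)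

(* Defs.v *)
From mathcomp Require Import all_boot all_order all_algebra.
From mathcomp Require Import boolp classical_sets reals.

Set Implicit Arguments.
Unset Strict Implicit.
Unset Printing Implicit Defensive.

Import Order.TTheory GRing.Theory Num.Theory.
Local Open Scope classical_set_scope.
Local Open Scope ring_scope.

(* Vectors of R^n are row vectors throughout, so that the spectracone and the
   row cone are subsets of the same type 'rV[R]_n. *)

Definition perron_similarity (R : realType) (n : nat) (S : 'M[R]_n) : Prop :=
  S \in unitmx /\
  exists D : 'M[R]_n,
    [/\ is_diag_mx D, ~~ is_scalar_mx D
      & S *m D *m invmx S \is a mxOver Num.nneg].

Definition spectracone (R : realType) (n : nat) (S : 'M[R]_n) :
    set 'rV[R]_n :=
  [set x | S *m diag_mx x *m invmx S \is a mxOver Num.nneg].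

Definition row_cone (R : realType) (n : nat) (S : 'M[R]_n) :
    set 'rV[R]_n :=
  [set x | exists2 c : 'I_n -> R,
             (forall i, 0 <= c i) & x = \sum_(i < n) c i *: row i S].

Definition hadamard (R : realType) (m n : nat) (A B : 'M[R]_(m, n)) :
    'M[R]_(m, n) :=
  map2_mx *%R A B.

Definition row_hadamard_conic (R : realType) (n : nat) (S : 'M[R]_n) : Prop :=
  forall i j : 'I_n, row_cone S (hadamard (row i S) (row j S)).

(* Main.v *)
Require Import Defs.
From mathcomp Require Import all_boot all_order all_algebra.
From mathcomp Require Import boolp classical_sets reals.
Import Order.TTheory GRing.Theory Num.Theory.
Local Open Scope classical_set_scope.
Local Open Scope ring_scope.

(* Row i of S diag(x) S^-1 is the coordinate vector of r_i o x in the basis of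
   rows of S.  So x is in the spectracone iff every r_i o x is in the row cone,
   and S is RHC iff the spectracone contains the rows of S; as the spectracone
   is a convex cone, this is to say that it contains the cone they generate. *)

Lemma mxOver_nneg_comb (R : realType) (m n : nat) (I : finType)
    (c : I -> R) (A : I -> 'M[R]_(m, n)) :
  (forall i, 0 <= c i) -> (forall i, A i \is a mxOver Num.nneg) ->
  \sum_i c i *: A i \is a mxOver Num.nneg.
Proof.
move=> c_ge0 A_ge0; apply/mxOverP=> j k.
rewrite summxE nnegrE sumr_ge0 // => i _; rewrite mxE mulr_ge0 //.
by have /mxOverP/(_ j k) := A_ge0 i; rewrite nnegrE.
Qed.

(** The rows of [S] form a basis, so the coefficients of [x] in them are unique: they are the
    entries of [x *m invmx S]. *)
Lemma row_coneP (R : realType) (n : nat) (S : 'M[R]_n) (x : 'rV[R]_n) :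
  S \in unitmx -> row_cone S x <-> x *m invmx S \is a mxOver Num.nneg.
Proof.
move=> uS; split=> [[c c_ge0 ->]|/mxOverP x_ge0].
  (* [row i S *m invmx S] is row [i] of the identity matrix, with entries 0 and 1. *)
  rewrite mulmx_suml; under eq_bigr do rewrite -scalemxAl -row_mul mulmxV //.
  apply: mxOver_nneg_comb => // i.
  by apply/mxOverP=> j k; rewrite !mxE nnegrE ler0n.
exists (fun i => (x *m invmx S) 0 i) => [i|].
  by have := x_ge0 0 i; rewrite nnegrE.
by rewrite -mulmx_sum_row mulmxKV.
Qed.

Lemma spectraconeP (R : realType) (n : nat) (S : 'M[R]_n) (x : 'rV[R]_n) :
  S \in unitmx ->
  spectracone S x <-> forall i, row_cone S (hadamard (row i S) x).
Proof.
move=> uS.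
have rowE i : row i (S *m diag_mx x *m invmx S)
            = hadamard (row i S) x *m invmx S.
  rewrite row_mul; congr (_ *m _); apply/rowP=> j.
  by rewrite mul_mx_diag !mxE.
split=> [/mxOverP x_ge0 i|x_ge0].
  apply/row_coneP => //; rewrite -rowE.
  by apply/mxOverP=> j k; rewrite mxE.
apply/mxOverP=> i j.
have /row_coneP-/(_ uS)/mxOverP/(_ 0 j) := x_ge0 i.
by rewrite -rowE mxE.
Qed.

(** The map from [x] to [S *m diag_mx x *m invmx S] is linear, so nonnegative combinations pass
    through it. *)
Lemma spectracone_comb (R : realType) (n : nat) (S : 'M[R]_n) (I : finType)
    (c : I -> R) (x : I -> 'rV[R]_n) :
  (forall i, 0 <= c i) -> (forall i, spectracone S (x i)) ->
  spectracone S (\sum_i c i *: x i).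
Proof.
move=> c_ge0 Sx; rewrite /spectracone /= linear_sum mulmx_sumr mulmx_suml.
under eq_bigr do rewrite linearZ -scalemxAr -scalemxAl.
exact: mxOver_nneg_comb.
Qed.

Lemma row_cone_row (R : realType) (n : nat) (S : 'M[R]_n) (i : 'I_n) :
  row_cone S (row i S).
Proof.
exists (fun j => (j == i)%:R) => [j|]; first exact: ler0n.
rewrite (bigD1 i) //= eqxx scale1r big1 ?addr0 // => j /negPf->.
exact: scale0r.
Qed.

Theorem theorem3p1 (R : realType) (n : nat) (S : 'M[R]_n)
    (hS : perron_similarity S) :
  row_cone S `<=` spectracone S <-> row_hadamard_conic S.
Proof.
have [uS _] := hS; split=> [sub i j|rhc x [c c_ge0 ->]].
  (* In both directions, [spectraconeP] at [row j S] is the RHC condition for this [j] and all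
     [i]. *)
  by have /spectraconeP-/(_ uS) := sub _ (row_cone_row R n S j); apply.
by apply: spectracone_comb => // j; apply/spectraconeP => // i; apply: rhc.
Qed.
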